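(* Let $k\ge 1$ be an integer and let $C,A>0$ be real constants. Then there exist constants $C',A'>0$, depending only on $k$ (and on the constants $C,A$ of the hypothesis), such that the following holds. For every polynomial $P_k$ of degree $k$ with integer coefficients and all integers $a,q,N$ with $q\neq 0$, $N\ge 2$ and $$d(q)\le C\, N^{\frac{1}{k(k+1)}}(\log N)^{A},$$ we have $$\bigl|\{t\in\mathbb{Z}:\ P_k(t)\in\{a+q,a+2q,\ldots,a+Nq\}\}\bigr|\le C'\,N^{\frac{2}{k}}(\log N)^{A'}.$$
   Context: For a nonzero integer $q$, $d(q)$ denotes the number of (positive) divisors of $q$. $|S|$ denotes the cardinality of a set $S$. *)

(* Defs.v *)
From mathcomp Require Import all_boot all_order all_algebra.
From mathcomp Require Import finmap.
From mathcomp Require Import all_classical all_reals all_analysis.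

Set Implicit Arguments.
Unset Strict Implicit.
Unset Printing Implicit Defensive.

Import Order.TTheory GRing.Theory Num.Theory.

Local Open Scope classical_set_scope.
Local Open Scope ring_scope.

(* Only meaningful for q != 0, since divisors 0 is the empty sequence. *)
Definition num_divisors (q : int) : nat := size (divisors `|q|%N).

Definition arith_prog (a q : int) (N : nat) : set int :=
  [set a + n%:Z * q | n in [set n : nat | (1 <= n <= N)%N]].

(* Main.v *)
Require Import Defs.
From mathcomp Require Import all_boot all_order all_algebra.
From mathcomp Require Import finmap.
From mathcomp Require Import all_classical all_reals all_analysis.
From mathcomp Require Import zify ring.

Set Implicit Arguments.
Unset Strict Implicit.
Unset Printing Implicit Defensive.

Import Order.TTheory GRing.Theory Num.Theory.

Local Open Scope classical_set_scope.
Local Open Scope ring_scope.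

(** Let c be the leading coefficient of P. Replacing P by P - a, the points t
to count satisfy q | P(t) and |P(t)| <= N |q|. Both conditions are turned into
information on the differences t_i - t_j by one identity, Lagrange
interpolation read in top degree, valid for k + 1 distinct points:

    c = sum_i P(t_i) / prod_(j != i) (t_i - t_j).

At a prime p, with p^e exactly dividing q, take valuations: if no two of the
k + 1 points were congruent mod p^(m+1), every term would have valuation at
least e - k m, so e <= k m + v_p(c) ([incongruent_points_bound]). Hence if m is
the least exponent with e <= k m + v_p(c), the points lie in at most k residue
classes mod p^m. Choosing one class for each prime keeps at least a fraction
k^(-omega(q)) of the points, all congruent modulo some Q with |q| <= Q^k |c|
([large_common_modulus]).

At the archimedean place, take absolute values: k + 1 points at mutual distance
at least B satisfy |c| B^k <= (k + 1) N |q| ([separated_points_bound]). Let X be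
an integer with X^k > (k + 1) N. The points that are congruent mod Q fall into
X classes mod Q X, and each class has at most k points, because k + 1 of them
would be at distance at least Q X and |c| (Q X)^k > (k + 1) N |q|. The number of
points is thus at most k^omega(q) X k ([count_small_multiples]), where the
factor c has cancelled between the two places.

Finally X = O(N^(1/k)), and k <= 2^(k+1) with 2^omega(q) <= d(q) give
k^omega(q) <= d(q)^(k+1), which the hypothesis on d(q) bounds by another
N^(1/k) times a power of log N. *)

(** * The leading coefficient as a divided difference *)

(** Comparison of the coefficients of X^k in the Lagrange interpolation formula
for a polynomial of degree k at k + 1 nodes. *)
Lemma lead_coef_interpolation (K : fieldType) (k : nat) (p : {poly K})
    (x : 'I_k.+1 -> K) :
  injective x -> size p = k.+1 ->
  lead_coef p = \sum_i p.[x i] / \prod_(j | j != i) (x i - x j).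
Proof.
move=> x_inj sz_p.
pose node (i : 'I_k.+1) : {poly K} := \prod_(j | j != i) ('X - (x j)%:P).
pose den (i : 'I_k.+1) := \prod_(j | j != i) (x i - x j).
have den_neq0 i : den i != 0.
  by apply/prodf_neq0 => j ji; rewrite subr_eq0 (inj_eq x_inj) eq_sym.
have sz_node i : size (node i) = k.+1.
  rewrite /node -big_filter size_prod_XsubC size_filter -sum1_count.
  by rewrite (sum1_card (predC1 i)) cardC1 card_ord.
pose r := \sum_i (p.[x i] / den i) *: node i.
have p_eq_r : p = r.
  apply/eqP; rewrite -subr_eq0; apply/eqP.
  apply: (@roots_geq_poly_eq0 _ _ [seq x i | i : 'I_k.+1]).
  - apply/allP => _ /mapP[i _ ->]; rewrite rootE !hornerE /r horner_sum.
    rewrite (bigD1 i) //= big1 => [|j ji]; last first.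
      rewrite hornerZ /node horner_prod (bigD1 i) /=; last by rewrite eq_sym.
      by rewrite hornerXsubC subrr mul0r mulr0.
    rewrite hornerZ /node horner_prod.
    under eq_bigr do rewrite hornerXsubC.
    by rewrite -/(den i) divfK // addr0 subrr.
  - by rewrite map_inj_uniq ?enum_uniq.
  - rewrite size_map size_enum_ord (leq_trans (size_polyD _ _))//.
    rewrite geq_max sz_p leqnn.
    rewrite size_polyN (leq_trans (size_sum _ _ _))//.
    apply/bigmax_leqP => i _.
    exact: leq_trans (size_scale_leq _ _) (eq_leq (sz_node i)).
rewrite lead_coefE sz_p /= {1}p_eq_r coef_sum; apply: eq_bigr => i _.
have /monicP : node i \is monic by apply: monic_prod => j _; apply: monicXsubC.
by rewrite lead_coefE sz_node /= coefZ => ->; rewrite mulr1.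
Qed.

Lemma lead_coef_interpolation_int (k : nat) (P : {poly int})
    (x : 'I_k.+1 -> int) :
  injective x -> size P = k.+1 ->
  (lead_coef P)%:~R =
    \sum_i P.[x i]%:~R / (\prod_(j | j != i) (x i - x j))%:~R :> rat.
Proof.
move=> x_inj sz_P; pose Q := map_poly (intr : int -> rat) P.
have inj_intr : injective (intr : int -> rat) by exact: intr_inj.
rewrite -(lead_coef_map_inj inj_intr) //.
rewrite (@lead_coef_interpolation _ k _ (fun i => (x i)%:~R)).
- apply: eq_bigr => i _; rewrite horner_map /= rmorph_prod.
  by congr (_ / _); apply: eq_bigr => j _; rewrite rmorphB.
- by move=> i j /inj_intr/x_inj.
- by rewrite size_map_inj_poly.
Qed.

(** * Consequences for the differences of the nodes *)

(** Every term of the interpolation identity is at most H / B^k in absolute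
value. *)
Lemma separated_points_bound (k B H : nat) (P : {poly int})
    (x : 'I_k.+1 -> int) :
  (0 < B)%N -> size P = k.+1 ->
  (forall i j, i != j -> (B <= `|x i - x j|)%N) ->
  (forall i, (`|P.[x i]| <= H)%N) ->
  (`|lead_coef P| * B ^ k <= k.+1 * H)%N.
Proof.
move=> B_gt0 sz_P sepx P_le.
have x_inj : injective x.
  move=> i j xij; apply/eqP; apply: contraT => /sepx.
  by rewrite xij subrr leqNgt B_gt0.
have normQ (z : int) : `|z%:~R : rat| = (`|z|%N)%:R.
  by rewrite -intr_norm -abszE.
have Bk_gt0 : 0 < (B ^ k)%:R :> rat by rewrite ltr0n expn_gt0 B_gt0.
rewrite -(ler_nat rat) natrM -ler_pdivlMr // -normQ.
rewrite (lead_coef_interpolation_int x_inj sz_P).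
apply: le_trans (ler_norm_sum _ _ _) _.
rewrite -[k.+1 in leRHS]card_ord -sum1_card natrM natr_sum mulr_suml.
rewrite mulr_suml; apply: ler_sum => i _; rewrite mul1r normrM normfV.
apply: ler_pM; rewrite ?invr_ge0 // ?normQ ?ler_nat //.
rewrite lef_pV2 ?posrE //; last first.
  rewrite -normQ normr_gt0 intr_eq0.
  by apply/prodf_neq0 => j ji; rewrite subr_eq0 (inj_eq x_inj) eq_sym.
rewrite ler_nat.
have -> : (B ^ k = \prod_(j < k.+1 | j != i) B)%N.
  by rewrite prod_nat_const (cardC1 i) card_ord.
rewrite (big_morph absz abszM (erefl _)).
by apply: leq_prod => j ji; apply: sepx; rewrite eq_sym.
Qed.

Lemma logn_prod_le (I : finType) (A : pred I) (p m : nat) (F : I -> nat) :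
  (forall i, A i -> (0 < F i)%N /\ (logn p (F i) <= m)%N) ->
  (logn p (\prod_(i | A i) F i) <= #|A| * m)%N.
Proof.
move=> F_le; rewrite -sum_nat_const.
suff [] : (0 < \prod_(i | A i) F i)%N /\
  (logn p (\prod_(i | A i) F i) <= \sum_(i | A i) m)%N by [].
elim/big_rec2: _ => [|i y n Ai [n_gt0 le_n]]; first by rewrite logn1.
have [F_gt0 le_F] := F_le _ Ai.
by rewrite muln_gt0 F_gt0 n_gt0 lognM // leq_add.
Qed.

(** The p-adic counterpart of [separated_points_bound]: each denominator
prod_(j != i) (x_i - x_j) has valuation at most k m, so every term of the
interpolation identity has valuation at least e - k m, hence so has their sum,
the leading coefficient. *)
Lemma incongruent_points_bound (p k m e : nat) (P : {poly int})
    (x : 'I_k.+1 -> int) :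
  prime p -> size P = k.+1 ->
  (forall i j, i != j -> ~~ (p ^ m.+1 %| `|x i - x j|)%N) ->
  (forall i, (p ^ e %| `|P.[x i]|)%N) ->
  (e <= k * m + logn p `|lead_coef P|)%N.
Proof.
move=> p_pr sz_P incx P_dvd.
have x_inj : injective x.
  move=> i j xij; apply/eqP; apply: contraT => /incx.
  by rewrite xij subrr dvdn0.
pose D i := \prod_(j | j != i) (x i - x j).
have D_neq0 i : D i != 0.
  by apply/prodf_neq0 => j ji; rewrite subr_eq0 (inj_eq x_inj) eq_sym.
have D_gt0 i : (0 < `|D i|)%N by rewrite absz_gt0.
have D_logn i : (logn p `|D i| <= k * m)%N.
  rewrite /D (big_morph absz abszM (erefl _)).
  have card_i : #|predC1 i| = k by rewrite cardC1 card_ord.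
  rewrite -[X in (_ <= X * m)%N]card_i; apply: logn_prod_le => j ji.
  have x_gt0 : (0 < `|x i - x j|)%N.
    by rewrite absz_gt0 subr_eq0 (inj_eq x_inj) eq_sym.
  split=> //; rewrite leqNgt -pfactor_dvdn //.
  by apply: incx; rewrite eq_sym.
pose D' i := \prod_(l | l != i) D l.
have D'_gt0 i : (0 < `|D' i|)%N by rewrite absz_gt0; apply/prodf_neq0.
have DD' i : \prod_l D l = D i * D' i by rewrite (bigD1 i).
(* Clearing denominators keeps the valuation argument within the integers. *)
have eq_c : lead_coef P * \prod_l D l = \sum_i P.[x i] * D' i.
  apply: (@intr_inj rat); rewrite rmorphM rmorph_sum /=.
  rewrite (lead_coef_interpolation_int x_inj sz_P) mulr_suml.
  apply: eq_bigr => i _; rewrite (DD' i) -/(D i) !rmorphM /= mulrA divfK //.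
  by rewrite intr_eq0.
have [le_e|lt_e] := leqP e (k * m)%N.
  by rewrite (leq_trans le_e) ?leq_addr.
have c_neq0 : lead_coef P != 0 by rewrite lead_coef_eq0 -size_poly_eq0 sz_P.
have prod_neq0 : \prod_l D l != 0 by apply/prodf_neq0.
move: (\prod_l D l) DD' eq_c prod_neq0 => Dall DD' eq_c Dall_neq0.
have : (p ^ (e - k * m + logn p `|Dall|) %| `|(lead_coef P * Dall)%R|)%N.
  rewrite eq_c -(absz_nat (p ^ _)) -dvdzE; apply: rpred_sum => i _.
  rewrite dvdzE abszM absz_nat (DD' i) abszM lognM // addnA expnD.
  apply: dvdn_mul; last by rewrite pfactor_dvdn.
  by apply: dvdn_trans (P_dvd i); apply: dvdn_exp2l; have := D_logn i; lia.
rewrite pfactor_dvdn // ?absz_gt0 ?mulf_neq0 // abszM lognM ?absz_gt0 //.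
by rewrite leq_add2r leq_subLR.
Qed.

(** * Passing to a subset with a large common modulus *)

Lemma pigeonhole_few_values (T U : eqType) (f : T -> U) (m : nat) (s : seq T) :
  (size (undup (map f s)) <= m)%N ->
  exists2 s', subseq s' s &
    (size s <= m * size s')%N /\ {in s' &, forall t t', f t = f t'}.
Proof.
move=> le_m; have [->|s_n0] := eqVneq s [::]; first by exists [::].
have s_gt0 : (0 < size s)%N by rewrite lt0n size_eq0.
(* Otherwise each of the at most m fibres would have fewer than size s / m
   elements, too few to make up s. *)
have [u le_u] : exists u, (size s <= m * count (fun t => f t == u) s)%N.
  apply: contrapT => /forallNP no_u.
  have: (m * size s <= m * (size s).-1)%N.
    have {1}-> : size s =
        (\sum_(u <- undup (map f s)) count (fun t => f t == u) s)%N.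
      under eq_bigr do rewrite -sum1_count.
      rewrite (exchange_big_dep xpredT) //= -sum1_size big_seq [RHS]big_seq.
      apply: eq_bigr => t ts.
      rewrite sum1_count.
      rewrite (@eq_count _ _ (pred1 (f t))) => [|u]; last first.
        by rewrite /= eq_sym.
      by rewrite count_uniq_mem ?undup_uniq // mem_undup map_f.
    rewrite big_distrr /=.
    apply: (@leq_trans (\sum_(u <- undup (map f s)) (size s).-1)%N).
      apply: leq_sum => u _; have /negP := no_u u; rewrite -ltnNge.
      by case: (size s).
    by rewrite big_const_seq count_predT iter_addn_0 mulnC leq_mul2r le_m orbT.
  rewrite leq_mul2l -[X in (X <= _)%N]prednK // ltnn orbF => /eqP m0.
  move: le_m; rewrite m0 leqn0 size_eq0 => /eqP/undup_nil.
  by case: (s) s_n0.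
exists [seq t <- s | f t == u]; first exact: filter_subseq.
split; first by rewrite size_filter.
by move=> t t'; rewrite !mem_filter => /andP[/eqP-> _] /andP[/eqP-> _].
Qed.

Lemma extract_distinct_values (T U : eqType) (f : T -> U) (k : nat)
    (s : seq T) :
  (k < size (undup (map f s)))%N ->
  exists2 x : 'I_k.+1 -> T, (forall i, x i \in s) & injective (f \o x).
Proof.
move=> lt_k; set us := undup _ in lt_k.
pose u i := tnth (in_tuple us) (widen_ord lt_k i).
have ex_x i : exists t, t \in s /\ f t = u i.
  have : u i \in us by apply: mem_tnth.
  by rewrite mem_undup => /mapP[t ts ->]; exists t.
have [x xP] := choice ex_x.
exists x => [i|i j /=]; first by have [] := xP i.
have [_ ->] := xP i; have [_ ->] := xP j.
have /tuple_uniqP u_inj : uniq (in_tuple us) by apply: undup_uniq.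
by rewrite /u => uij; apply: val_inj; have /(congr1 val) := u_inj _ _ uij.
Qed.

(** One pigeonhole step for each modulus: the hypothesis of few residues is
inherited by subsequences, so the losses multiply. *)
Lemma subset_congruent_mod (k : nat) (ms : seq nat) (s : seq int) :
  (forall m, m \in ms -> size (undup [seq (t %% m%:Z)%Z | t <- s]) <= k)%N ->
  exists2 s', subseq s' s & (size s <= k ^ size ms * size s')%N /\
    {in ms, forall m, {in s' &, forall t t' : int, (m %| `|t - t'|)%N}}.
Proof.
elim: ms => [|m ms IHms] few; first by exists s; rewrite // expn0 mul1n.
have [|s1 sub1 [le1 congr1]] := IHms.
  by move=> m' m'ms; apply: few; rewrite inE m'ms orbT.
have few1 : (size (undup [seq (t %% m%:Z)%Z | t <- s1]) <= k)%N.
  apply: leq_trans (few m (mem_head _ _)).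
  apply: uniq_leq_size (undup_uniq _) _.
  move=> r; rewrite !mem_undup; exact/mem_subseq/map_subseq.
have [s2 sub2 [le2 congr2]] := pigeonhole_few_values few1.
exists s2; first exact: subseq_trans sub2 sub1.
split; first by rewrite expnSr (leq_trans le1) // -mulnA leq_mul2l le2 orbT.
move=> m'; rewrite inE => /predU1P[->|m'ms] t t' ts ts'; last first.
  by apply: congr1 => //; apply: (mem_subseq sub2).
by rewrite -(absz_nat m) -dvdzE -eqz_mod_dvd; apply/eqP/congr2.
Qed.

(** Representatives of k + 1 distinct classes mod p^(m+1) would contradict
[incongruent_points_bound]. *)
Lemma few_residues (p e k m : nat) (P : {poly int}) (s : seq int) :
  prime p -> size P = k.+1 -> {in s, forall t, (p ^ e %| `|P.[t]|)%N} ->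
  (k * m + logn p `|lead_coef P| < e)%N ->
  (size (undup [seq (t %% (p ^ m.+1)%:Z)%Z | t <- s]) <= k)%N.
Proof.
move=> p_pr sz_P P_dvd lt_e; rewrite leqNgt; apply/negP.
move=> /extract_distinct_values[x xs x_inj].
suff: (e <= k * m + logn p `|lead_coef P|)%N by rewrite leqNgt lt_e.
apply: (incongruent_points_bound p_pr sz_P (x := x)) => [i j|i];
  last exact: P_dvd.
apply: contra_neqN => dvd_ij; apply: x_inj => /=.
by apply/eqP; rewrite eqz_mod_dvd dvdzE absz_nat.
Qed.

(** The points lie in at most k classes modulo p^m for the least m with
v_p(q) <= k m + v_p(c), where c is the leading coefficient. These prime powers
are the moduli; by the choice of m, their least common multiple Q is so large
that q divides Q^k c. *)
Lemma large_common_modulus (k q : nat) (P : {poly int}) (s : seq int) :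
  (0 < k)%N -> (0 < q)%N -> size P = k.+1 ->
  {in s, forall t, (q %| `|P.[t]|)%N} ->
  exists2 s', subseq s' s & exists Q,
    [/\ (size s <= k ^ size (primes q) * size s')%N,
        {in s' &, forall t t' : int, (Q %| `|t - t'|)%N}, (0 < Q)%N &
        (q <= Q ^ k * `|lead_coef P|)%N].
Proof.
move=> k_gt0 q_gt0 sz_P P_dvd.
have c_gt0 : (0 < `|lead_coef P|)%N.
  by rewrite absz_gt0 lead_coef_eq0 -size_poly_eq0 sz_P.
have ex_m p : exists m, (logn p q <= k * m + logn p `|lead_coef P|)%N.
  by exists (logn p q); nia.
pose m p := ex_minn (ex_m p).
have [|s' sub_s' [le_s congr_s]] :=
    @subset_congruent_mod k [seq p ^ m p | p <- primes q]%N s.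
  (* A null exponent gives the modulus 1, with a single class; for n.+1 the
     minimality says that n is too small, as few_residues requires. *)
  move=> _ /mapP[p p_q ->]; rewrite /m; case: ex_minnP => -[|n] _ min_n.
    apply: (@leq_trans 1%N) => //.
    apply: (@uniq_leq_size _ _ [:: 0]) (undup_uniq _) _ => r.
    by rewrite mem_undup => /mapP[t _ ->]; rewrite expn0 modz1 inE.
  move: p_q; rewrite mem_primes => /and3P[p_pr _ _].
  apply: (few_residues p_pr sz_P (e := logn p q)).
    by move=> t ts; apply: dvdn_trans (P_dvd t ts); apply: pfactor_dvdnn.
  by rewrite ltnNge; apply/negP => /min_n; rewrite ltnn.
exists s' => //; rewrite size_map in le_s.
pose Q := (\big[lcmn/1]_(p <- primes q) p ^ m p)%N.
have dvdQ p : p \in primes q -> (p ^ m p %| Q)%N.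
  by move=> pq; rewrite /Q (big_rem p) //= dvdn_lcml.
have Q_gt0 : (0 < Q)%N.
  rewrite /Q big_seq; elim/big_rec: _ => // p d.
  rewrite mem_primes => /and3P[p_pr _ _].
  by move=> d_gt0; rewrite lcmn_gt0 expn_gt0 prime_gt0.
exists Q; split=> //.
  move=> t t' ts ts'; rewrite /Q big_seq; elim/big_rec: _ => [|p d pq dvd_d].
    exact: dvd1n.
  rewrite dvdn_lcm dvd_d andbT; apply: (congr_s (p ^ m p)%N) => //.
  by apply/mapP; exists p.
apply: dvdn_leq; first by rewrite muln_gt0 expn_gt0 Q_gt0.
apply/(dvdn_partP _ q_gt0) => p; rewrite mem_primes => /and3P[p_pr _ pq].
rewrite p_part.
apply: dvdn_trans (_ : p ^ (k * m p + logn p `|lead_coef P|) %| _)%N.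
  by apply: dvdn_exp2l; rewrite /m; case: ex_minnP.
rewrite expnD dvdn_mul ?pfactor_dvdnn // mulnC expnM dvdn_exp2r //.
by apply: dvdQ; rewrite mem_primes p_pr q_gt0.
Qed.

(** * Counting *)

(** A class mod Q splits into X classes mod Q X. *)
Lemma few_lifted_residues (Q X : nat) (s : seq int) :
  (0 < Q)%N -> (0 < X)%N ->
  {in s &, forall t t' : int, (Q %| `|t - t'|)%N} ->
  (size (undup [seq (t %% (Q * X)%N%:Z)%Z | t <- s]) <= X)%N.
Proof.
move=> Q_gt0 X_gt0; case: s => [//|t0 s] congr_s.
rewrite -[leqRHS](size_iota 0).
rewrite -(size_map (fun i : nat => (t0 %% Q)%Z + i%:Z * Q%:Z)).
apply: uniq_leq_size (undup_uniq _) _ => r.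
rewrite mem_undup => /mapP[t ts r_def].
have QX_gt0 : 0 < (Q * X)%N%:Z by rewrite ltz_nat muln_gt0 Q_gt0.
have r_ge0 : 0 <= r by rewrite r_def modz_ge0 // gt_eqF.
have r_lt : r < (Q * X)%N%:Z by rewrite r_def ltz_pmod.
have r_modQ : (r %% Q = t0 %% Q)%Z.
  transitivity (t %% Q)%Z.
    by rewrite [in RHS](divz_eq t (Q * X)%N) -r_def PoszM
      [Q%:Z * X]mulrC mulrA modzMDl.
  by apply/eqP; rewrite eqz_mod_dvd dvdzE absz_nat congr_s // mem_head.
have d_ge0 : 0 <= (r %/ Q)%Z by rewrite divz_ge0.
apply/mapP; exists `|(r %/ Q)%Z|%N.
  rewrite mem_iota /= add0n -ltz_nat gez0_abs // ltz_divLR ?ltz_nat //.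
  by rewrite -PoszM mulnC.
by rewrite gez0_abs // -r_modQ addrC -divz_eq.
Qed.

(** Two points that are congruent mod Q X are at distance at least Q X; this
makes a class mod Q X a set of separated points, to which the archimedean bound
applies. The leading coefficient disappears because q <= Q^k |c|. *)
Lemma count_small_multiples (k q N X : nat) (P : {poly int}) (s : seq int) :
  (0 < k)%N -> (0 < q)%N -> size P = k.+1 -> (k.+1 * N < X ^ k)%N ->
  uniq s -> {in s, forall t, (q %| `|P.[t]|)%N /\ (`|P.[t]| <= N * q)%N} ->
  (size s <= k ^ size (primes q) * (X * k))%N.
Proof.
move=> k_gt0 q_gt0 sz_P lt_X uniq_s Ps.
have X_gt0 : (0 < X)%N by move: lt_X; case: (X) => //; rewrite exp0n.
have [|s1 sub1 [Q [le1 congr1 Q_gt0 le_q]]] :=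
  @large_common_modulus k q P s k_gt0 q_gt0 sz_P.
  by move=> t /Ps[].
apply: leq_trans le1 _; rewrite leq_mul2l; apply/orP; right.
have QX_gt0 : (0 < Q * X)%N by rewrite muln_gt0 Q_gt0.
have few : (size (undup [seq (t %% (Q * X)%N%:Z)%Z | t <- s1]) <= X)%N.
  exact: few_lifted_residues.
have [s2 sub2 [le2 congr2]] := pigeonhole_few_values few.
apply: leq_trans le2 _; rewrite leq_mul2l; apply/orP; right.
rewrite leqNgt; apply/negP => lt_k.
have uniq_s2 : uniq s2 by apply: subseq_uniq sub2 (subseq_uniq sub1 uniq_s).
have [|x xs x_inj] := @extract_distinct_values _ _ id k s2.
  by rewrite map_id undup_id.
have sep i j : i != j -> (Q * X <= `|x i - x j|)%N.
  move=> ij; apply: dvdn_leq.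
    by rewrite absz_gt0 subr_eq0 (inj_eq x_inj).
  by rewrite -(absz_nat (Q * X)) -dvdzE -eqz_mod_dvd; apply/eqP/congr2.
have P_le i : (`|P.[x i]| <= N * q)%N.
  by have /Ps[] := mem_subseq sub1 (mem_subseq sub2 (xs i)).
have := separated_points_bound QX_gt0 sz_P sep P_le.
apply/negP; rewrite -ltnNge.
have -> : (`|lead_coef P| * (Q * X) ^ k = (Q ^ k * `|lead_coef P|) * X ^ k)%N.
  by rewrite expnMn; lia.
rewrite mulnA [(_ * q)%N]mulnC.
apply: (@leq_trans (q * X ^ k)%N); first by rewrite ltn_pmul2l.
by rewrite leq_mul2r le_q orbT.
Qed.

(** * The number of divisors controls the number of prime factors *)

(** Each prime p of exponent e multiplies the number of divisors by
e + 1 >= 2. *)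
Lemma exp2_primes_leq_divisors n : (0 < n)%N ->
  (2 ^ size (primes n) <= size (divisors n))%N.
Proof.
move=> n_gt0; rewrite /primes size_map /divisors.
have: all (fun f : nat * nat => 0 < f.2)%N (prime_decomp n).
  by apply/allP => -[p e] /mem_prime_decomp[].
elim: (prime_decomp n) => //= -[p e] l IHl /andP[/= e_gt0 /IHl].
set m := size l; set ds := foldr _ _ _ => le_ds.
suff -> : size (PrimeDecompAux.add_divisors (p, e) ds) = (e.+1 * size ds)%N.
  by rewrite expnS leq_mul.
rewrite /PrimeDecompAux.add_divisors; elim: e {e_gt0} => [|e IHe].
  by rewrite mul1n.
by rewrite iterS size_merge size_cat size_map IHe mulSn addnC.
Qed.

(** Since k <= 2^(k+1), the left-hand side is at most the (k+1)-st power of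
2^omega(q), which is a lower bound for d(q). The exponent k + 1 is the one that
turns the bound N^(1/(k(k+1))) on d(q) into N^(1/k). *)
Lemma exp_omega_le_num_divisors (k : nat) (q : int) : q != 0 ->
  (k ^ size (primes `|q|) <= num_divisors q ^ k.+1)%N.
Proof.
move=> q_neq0.
have le_k : (k <= 2 ^ k.+1)%N by apply/ltnW/ltnW; apply: ltn_expl.
apply: (@leq_trans ((2 ^ k.+1) ^ size (primes `|q|))%N).
  by case: (size _) => // w; rewrite leq_exp2r.
rewrite -expnM mulnC expnM leq_exp2r // exp2_primes_leq_divisors //.
by rewrite absz_gt0.
Qed.

(** * The bound *)

Theorem theorem1p2 (R : realType) (k : nat) (C A : R)
    (k_ge1 : (1 <= k)%N) (C_gt0 : 0 < C) (A_gt0 : 0 < A) :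
  exists C' A' : R, 0 < C' /\ 0 < A' /\
    forall (P : {poly int}) (a q : int) (N : nat),
      size P = k.+1 -> q != 0 -> (2 <= N)%N ->
      (num_divisors q)%:R
        <= C * N%:R `^ (1 / (k%:R * (k%:R + 1))) * ln N%:R `^ A ->
      let S := [set t : int | arith_prog a q N P.[t]] in
      finite_set S /\
      (#|` fset_set S|)%:R <= C' * N%:R `^ (2 / k%:R) * ln N%:R `^ A'.
Proof.
exists (C ^+ k.+1 * (k.+2%:R * k%:R)), (A * k.+1%:R).
split; first by rewrite !mulr_gt0 ?exprn_gt0 ?ltr0n.
split; first by rewrite mulr_gt0 ?ltr0n.
move=> P a q N sz_P q_neq0 N_ge2 d_le S.
have k_neq0 : k%:R != 0 :> R by rewrite pnatr_eq0 -lt0n.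
have N_gt0 : (0 < N)%N by apply: ltnW.
set y : R := N%:R `^ (1 / k%:R).
have y_gt0 : 0 < y by rewrite powR_gt0 // ltr0n.
have yk : y ^+ k = N%:R.
  by rewrite -powR_mulrn ?powR_ge0 // -powRrM div1r mulVf // powRr1.
have y_ge1 : 1 <= y.
  by rewrite -(@expr_ge1 _ k) ?(ltW y_gt0) // yk ler1n.
(* Any integer above (k + 1) N^(1/k) has a k-th power above (k + 1) N. *)
pose X := (Num.truncn (k.+1%:R * y)).+1.
have ky_ge0 : 0 <= k.+1%:R * y by rewrite mulr_ge0 // ltW.
have /andP[X_le lt_X] := truncn_itv ky_ge0.
have X_pow : (k.+1 * N < X ^ k)%N.
  rewrite -(ltr_nat R) natrX natrM -yk.
  apply: le_lt_trans (_ : (k.+1%:R * y) ^+ k < _); last first.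
    by rewrite ltrXn2r // -lt0n.
  rewrite exprMn ler_wpM2r ?exprn_ge0 ?(ltW y_gt0) //.
  by rewrite ler_eXnr // ler1n.
have X_le_y : X%:R <= k.+2%:R * y.
  rewrite /X -natr1 -[k.+2%:R]natr1 mulrDl mul1r; exact: lerD.
pose Q := P - a%:P.
have sz_Q : size Q = k.+1.
  rewrite size_polyDl // size_polyN sz_P.
  exact: leq_ltn_trans (size_polyC_leq1 _) _.
have S_mult t : S t -> (`|q| %| `|Q.[t]|)%N /\ (`|Q.[t]| <= N * `|q|)%N.
  move=> [n /= /andP[_ n_le] nP]; rewrite !hornerE -nP [a + _]addrC addrK.
  by rewrite abszM absz_nat dvdn_mull // leq_mul2r n_le orbT.
pose bound := (num_divisors q ^ k.+1 * (X * k))%N.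
have S_bound (F : {fset int}) : [set` F] `<=` S -> (#|` F| <= bound)%N.
  move=> F_sub.
  have q_gt0 : (0 < `|q|)%N by rewrite absz_gt0.
  have := count_small_multiples k_ge1 q_gt0 sz_Q X_pow (fset_uniq F).
  move/(_ _)/leq_trans; apply.
    by move=> t /F_sub/S_mult.
  by rewrite leq_mul2r exp_omega_le_num_divisors ?orbT.
have S_fin : finite_set S.
  apply: contrapT => /(infinite_set_fset bound.+1)[F /S_bound].
  by rewrite leqNgt => /negP.
split=> //.
apply: le_trans (_ : bound%:R <= _).
  by rewrite ler_nat S_bound // fset_setK.
rewrite /bound natrM natrX natrM.
set L := ln _ `^ A in d_le; set M := N%:R `^ _ in d_le.
have Mk : M ^+ k.+1 = y.
  rewrite -powR_mulrn ?powR_ge0 // -powRrM -natr1; congr (_ `^ _).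
  have k1_neq0 : k%:R + 1 != 0 :> R by rewrite natr1 pnatr_eq0.
  by field; rewrite k_neq0 k1_neq0.
have Lk : L ^+ k.+1 = ln N%:R `^ (A * k.+1%:R).
  by rewrite -powR_mulrn ?powR_ge0 // -powRrM.
have y2 : N%:R `^ (2 / k%:R) = y * y.
  rewrite -powRD; last by rewrite pnatr_eq0 -lt0n N_gt0 implybT.
  by rewrite -mulrDl.
have d_pow : (num_divisors q)%:R ^+ k.+1 <= C ^+ k.+1 * y * L ^+ k.+1.
  by rewrite -Mk -!exprMn lerXn2r // nnegrE ?mulr_ge0 ?powR_ge0 // ltW.
rewrite -Lk y2.
have Xk_le : X%:R * k%:R <= k.+2%:R * y * k%:R by rewrite ler_wpM2r.
apply: le_trans (ler_pM _ _ d_pow Xk_le) _; rewrite ?exprn_ge0 ?mulr_ge0 //.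
by rewrite le_eqVlt; apply/orP; left; apply/eqP; ring.
Qed.
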